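(* Let $\mathcal{K}=\prod_{j=1}^{n}\mathcal{K}_{j}\subset\mathbb{R}^n$ and $\gamma_1,\dots,\gamma_n$ be as in the context. Suppose that $\boldsymbol{\tau}=(\tau_{1}, \dots , \tau_{n}) \in \mathbb{R}^{n}_{+}$ and $\sum_{i=1}^{n}\tau_{i}\gamma_{i}=1$. Then $\mu(\mathbf{Bad}_{\operatorname{Int}}(\mathcal{K};\boldsymbol{\tau}))=0$, where $\mu$ is the canonical self-similar measure of $\mathcal{K}$.
   Context: Fix integers $r\ge 2$ and $n\ge1$. For each $1\le j\le n$ let $\Lambda_j$ be a finite collection of maps $f^{(j)}_i:[0,1]\to[0,1]$ of the form $f^{(j)}_i(x)=\frac{x+a_i}{r}$ with $0\le a_i\le r-1$ integers, and let $\mathcal{K}_j$ be the attractor of $\Lambda_j$, i.e. the unique nonempty compact set with $\mathcal{K}_j=\bigcup_{i\in\Lambda_j}f^{(j)}_i(\mathcal{K}_j)$; its dimension is $\gamma_j=\dim\mathcal{K}_j=\frac{\log\#\Lambda_j}{\log r}$. Let $\Lambda=\prod_{j=1}^n\Lambda_j$, and for $\mathbf{i}=(i_1,\dots,i_n)\in\Lambda$ let $\mathbf{f}_{\mathbf{i}}:[0,1]^n\to[0,1]^n$ act coordinatewise by $x_j\mapsto \frac{x_j+a_{i_j}}{r}$. Then $\mathcal{K}=\prod_{j=1}^n\mathcal{K}_j$ is the attractor of $\Lambda$, with $\dim\mathcal{K}=\gamma=\sum_{j=1}^n\gamma_j$. The canonical self-similar measure $\mu$ of $\mathcal{K}$ is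 the unique Borel probability measure supported on $\mathcal{K}$ with $\mu(A)=\sum_{\mathbf{i}\in\Lambda}r^{-\gamma}\mu(\mathbf{f}_{\mathbf{i}}^{-1}(A))$ for all Borel $A\subset\mathbb{R}^n$ (equivalently $\mu=\prod_j\mu_j$ with $\mu_j$ the canonical self-similar measure of $\mathcal{K}_j$). The set of weighted intrinsically badly approximable points is $\mathbf{Bad}_{\operatorname{Int}}(\mathcal{K};\boldsymbol{\tau})=\left\{ \mathbf{x}=(x_i)_{i=1}^n\in \mathcal{K} : \exists\, c(\mathbf{x})>0 \text{ such that for all } \tfrac{\mathbf{p}}{q}\in\mathbb{Q}^n\cap\mathcal{K} \text{ there is } i \text{ with } \left|x_{i}-\tfrac{p_{i}}{q}\right|\geq \tfrac{c(\mathbf{x})}{q(\log q)^{\tau_i}}\right\}$. *)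

(* Defs.v *)
From HB Require Import structures.
From mathcomp Require Import all_boot all_order all_algebra.
From mathcomp Require Import all_classical all_reals all_analysis.

Set Implicit Arguments.
Unset Strict Implicit.
Unset Printing Implicit Defensive.

Import Order.TTheory GRing.Theory Num.Theory.
Import numFieldNormedType.Exports.

Local Open Scope classical_set_scope.
Local Open Scope ring_scope.

(* R^n with its Borel sigma-algebra, i.e. the one generated by the open sets. *)
Notation borelRn R n := (g_sigma_algebraType (@open 'rV[R]_n)).

Definition digit_map (R : realType) (r : nat) (a : 'I_r) (x : R) : R :=
  (x + a%:R) / r%:R.

(* A finite collection of maps x |-> (x + a) / r is given by its set D of
   digits a. As the attractor is nonempty, D is nonempty too. *)
Definition is_attractor (R : realType) (r : nat) (D : {set 'I_r})
    (K : set R) : Prop :=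
  [/\ K !=set0, compact K, K `<=` `[0, 1]
    & K = \bigcup_(a in [set` D]) (digit_map a @` K)].

Definition digit_dim (R : realType) (r : nat) (D : {set 'I_r}) : R :=
  ln #|D|%:R / ln r%:R.

Definition prod_set (R : realType) (n : nat) (K : 'I_n -> set R)
  : set 'rV[R]_n := [set x | forall j, K j (x 0 j)].

Definition prod_digits (r n : nat) (D : 'I_n -> {set 'I_r})
  : {set {ffun 'I_n -> 'I_r}} := 
  [set i : {ffun 'I_n -> 'I_r} | [forall j, i j \in D j]]%SET.

Definition prod_map (R : realType) (r n : nat) (i : {ffun 'I_n -> 'I_r})
    (x : 'rV[R]_n) : 'rV[R]_n := \row_j digit_map (i j) (x 0 j).

Definition prod_dim (R : realType) (r n : nat) (D : 'I_n -> {set 'I_r}) : R :=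
  \sum_(j < n) digit_dim R (D j).

Definition is_canonical_measure (R : realType) (r n : nat)
    (D : 'I_n -> {set 'I_r}) (K : set 'rV[R]_n)
    (mu : probability (borelRn R n) R) : Prop :=
  mu (~` K) = 0%E /\
  forall A : set (borelRn R n), measurable A ->
    mu A = (\sum_(i in prod_digits D)
              (r%:R `^ (- prod_dim R D))%:E * mu (prod_map i @^-1` A))%E.

Definition rational_point (R : realType) (n : nat) (p : 'I_n -> int) (q : nat)
  : 'rV[R]_n := \row_j ((p j)%:~R / q%:R).

(* The denominator q = 1 is left out because log 1 = 0. The fraction p / q need
   not be in lowest terms; in particular a point with integer coordinates is
   still taken into account, with q = 2. *)
Definition Bad_Int (R : realType) (n : nat) (K : set 'rV[R]_n)
    (tau : 'I_n -> R) : set 'rV[R]_n :=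
  [set x | K x /\
    exists2 c : R, 0 < c &
      forall (p : 'I_n -> int) (q : nat), (1 < q)%N ->
        K (rational_point R p q) ->
        exists i, c / (q%:R * ln q%:R `^ tau i)
                  <= `|x 0 i - (p i)%:~R / q%:R| ].

(* Main.v *)
(* For a word u of length m and digits a_j in D_j, the point of K whose digits
   are u followed by the constant a_j has denominator r^m (r - 1). If the m-th
   digit of x_j is followed by a run of l_j digits a_j, such a point lies within
   r^-(m + l_j) of x_j, which beats c / (q (log q)^tau_j) once
   l_j = tau_j log_r m + O(1). Under mu this has probability
   r^-(sum_j gamma_j l_j), which is at least a constant times 1 / m as
   sum_j tau_j gamma_j = 1. Runs read in disjoint windows are independent;
   windows have length O(log m), so one can choose them disjoint with
   probabilities summing like sum 1 / (m log m) over m, i.e. diverging. Hence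
   almost every x meets such a run infinitely often.
   Independence is replaced by mu(A) = #Lambda^-1 sum_i mu(f_i^-1 A), applied
   digit by digit, so no symbolic coding of K is needed. *)
Require Import Defs.
From HB Require Import structures.
From mathcomp Require Import all_boot all_order all_algebra.
From mathcomp Require Import all_classical all_reals all_analysis.
From mathcomp Require Import ring lra.

Set Implicit Arguments.
Unset Strict Implicit.
Unset Printing Implicit Defensive.

Import Order.TTheory GRing.Theory Num.Theory.
Import numFieldNormedType.Exports.

Local Open Scope classical_set_scope.
Local Open Scope ring_scope.

(** * Real sequences: decay against a divergent series *)

(** The factor [1 - p] cancels the increment [p] up to a nonpositive error, so [k] successive decays
    yield a growth term linear in [k]. *)
Lemma expr_onem_mul_le1 (R : realFieldType) (p : R) (k : nat) :
  0 <= p -> p <= 1 -> (1 - p) ^+ k * (1 + p *+ k) <= 1.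
Proof.
move=> p0 p1; elim: k => [|k IH]; first by rewrite expr0 mulr0n addr0 mulr1.
apply: le_trans IH; rewrite exprSr -mulrA ler_wpM2l ?exprn_ge0 ?subr_ge0//.
have h : 0 <= p * (p *+ k) by rewrite mulr_ge0 ?mulrn_wge0.
have -> : (1 - p) * (1 + p *+ k.+1) = 1 + p *+ k - (p * p + p * (p *+ k)).
  by rewrite mulrS; ring.
by rewrite lerBlDr lerDl addr_ge0// mulr_ge0.
Qed.

Lemma harmonic_sum_unbounded (R : realType) (B : R) :
  exists M : nat, B <= \sum_(N < M) (N.+1%:R)^-1.
Proof.
apply: contrapT => /forallNP hB; apply: (@dvg_harmonic R).
apply: nondecreasing_is_cvgn.
  apply/nondecreasing_seqP => n; rewrite seriesSr lerDl /=.
  by rewrite invr_ge0.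
exists B => _ [n _ <-]; rewrite /series /= big_mkord.
by apply: ltW; rewrite ltNge; apply/negP; exact: hB.
Qed.

Lemma geometric_sum_le2 (R : realFieldType) (M : nat) :
  \sum_(N < M) (2%:R ^+ N)^-1 <= 2 :> R.
Proof.
suff -> : \sum_(N < M) (2%:R ^+ N)^-1 = 2 - 2 / 2 ^+ M :> R.
  by rewrite lerBlDr lerDl divr_ge0 ?exprn_ge0.
elim: M => [|M IH]; first by rewrite big_ord0 expr0; lra.
rewrite big_ord_recr /= IH exprS.
by field; rewrite expf_neq0 ?pnatr_eq0.
Qed.

(** Iteration gives [u 0 * (1 + \sum_(N < M) a N) <= u M <= 1] with unbounded sums. This takes the
    place of the second Borel-Cantelli lemma. *)
Lemma eq0_of_growth (R : realFieldType) (u a : nat -> R) :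
  (forall N, 0 <= u N <= 1) -> (forall N, 0 <= a N) ->
  (forall N, u N * (1 + a N) <= u N.+1) ->
  (forall B, exists M : nat, B <= \sum_(N < M) a N) -> u 0 = 0.
Proof.
move=> hu ha hs hd.
have H M : u 0 * (1 + \sum_(N < M) a N) <= u M.
  elim: M => [|M IH]; first by rewrite big_ord0 addr0 mulr1.
  rewrite big_ord_recr /=; apply: le_trans (hs M).
  apply: le_trans (ler_wpM2r _ IH); last by rewrite addr_ge0.
  rewrite -mulrA ler_wpM2l//; first by case/andP: (hu 0).
  have h1 : 0 <= \sum_(i < M) a i by apply: sumr_ge0.
  rewrite mulrDr mulr1 mulrDl mul1r addrA lerD2l lerDl.
  by rewrite mulr_ge0.
case/andP: (hu 0) => u0 _; apply/eqP; rewrite -[_ == _]negbK; apply/negP.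
rewrite neq_lt ltNge u0 /= => up.
have [M hM] := hd (u 0)^-1.
have := le_trans (H M) (proj2 (andP (hu M))).
rewrite leNgt => /negP; apply.
apply: (@lt_le_trans _ _ (u 0 * (1 + (u 0)^-1))).
  by rewrite mulrDr mulr1 divff ?gt_eqF// ltrDr.
by rewrite ler_wpM2l// lerD2l.
Qed.

(* Between r^N and r^(N+1) there is room for about r^N / (B (N+1)) disjoint
   windows, each costing a factor 1 - c / r^N; their total weight is of order
   1 / (N+1), the general term of the harmonic series. *)
Lemma eq0_of_window_decay (R : realType) (r B : nat) (c : R) (u : nat -> R) :
  (2 <= r)%N -> (0 < B)%N -> 0 < c -> c <= 1 ->
  (forall s, 0 <= u s <= 1) -> (forall s, u s <= u s.+1) ->
  (forall s, (0 < s)%N ->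
     u s <= (1 - c / r%:R ^+ trunc_log r s) * u (s + B * (trunc_log r s).+1)%N)
  -> u 1%N = 0.
Proof.
move=> hr hB c0 c1 hu hm hs.
have r0 : 0 < r%:R :> R by rewrite ltr0n; case: (r) hr.
have rN1 N : 1 <= r%:R ^+ N :> R by rewrite exprn_ege1// ler1n; case: (r) hr.
have rN0 N : 0 < r%:R ^+ N :> R by rewrite exprn_gt0.
have p0 N : 0 <= c / r%:R ^+ N by rewrite divr_ge0// ltW.
have p1 N : c / r%:R ^+ N <= 1.
  by rewrite ler_pdivrMr// mul1r (le_trans c1).
have um : {homo u : m n / (m <= n)%N >-> m <= n}.
  by apply/nondecreasing_seqP => n; exact: hm.
(* As many windows of length [B * N.+1] as fit between [r ^ N] and [r ^ N.+1], where [trunc_log r]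
   is constantly [N]. *)
pose k N := ((r ^ N.+1 - r ^ N) %/ (B * N.+1))%N.
have hrN N : (r ^ N <= r ^ N.+1)%N by rewrite leq_exp2l.
have win N j : (j * (B * N.+1) <= r ^ N.+1 - r ^ N)%N ->
    u (r ^ N)%N <= (1 - c / r%:R ^+ N) ^+ j * u (r ^ N + j * (B * N.+1))%N.
  elim: j => [|j IH] hj; first by rewrite expr0 mul1r mul0n addn0.
  have hj' : (j * (B * N.+1) < r ^ N.+1 - r ^ N)%N.
    by apply: leq_trans hj; rewrite mulSn -addn1 addnC leq_add2r muln_gt0 hB.
  apply: (le_trans (IH (ltnW hj'))).
  rewrite exprSr -mulrA ler_wpM2l ?exprn_ge0 ?subr_ge0//.
  set s := (r ^ N + j * (B * N.+1))%N.
  have s0 : (0 < s)%N by rewrite addn_gt0 expn_gt0 (ltnW hr).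
  have sN : trunc_log r s = N.
    apply: trunc_log_eq => //; rewrite leq_addr /= /s.
    by rewrite -(subnKC (hrN N)) ltn_add2l.
  by have := hs s s0; rewrite sN /s mulSnr addnA.
pose a N := (c / r%:R ^+ N) *+ k N.
have := @eq0_of_growth _ (fun N => u (r ^ N)%N) a.
rewrite expn0; apply => //.
- by move=> N; rewrite mulrn_wge0.
- move=> N.
  have hk : (k N * (B * N.+1) <= r ^ N.+1 - r ^ N)%N by exact: leq_divM.
  have /andP[uN0 _] := hu (r ^ N.+1)%N.
  have kle : u (r ^ N)%N <= (1 - c / r%:R ^+ N) ^+ k N * u (r ^ N.+1)%N.
    apply: (le_trans (win N _ hk)).
    rewrite ler_wpM2l ?exprn_ge0 ?subr_ge0//; apply: um.
    by rewrite -[leqRHS](subnKC (hrN N)) leq_add2l.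
  apply: (@le_trans _ _
    (((1 - c / r%:R ^+ N) ^+ k N * u (r ^ N.+1)%N) * (1 + a N))).
    by rewrite ler_wpM2r// addr_ge0// mulrn_wge0.
  rewrite mulrAC; apply: ler_piMl => //; exact: expr_onem_mul_le1.
(* The 2 pays for the rounding in [k N]: at most one window is lost, of weight
   [c / r ^ N <= c / 2 ^ N], and these weights sum to at most [2 * c]. *)
move=> M; have [n hn] := @harmonic_sum_unbounded R (B%:R * (M / c + 2)).
exists n.
have B0 : 0 < B%:R :> R by rewrite ltr0n.
have ha N : c * ((B%:R * N.+1%:R)^-1 - (2%:R ^+ N)^-1) <= a N.
  rewrite /a -mulrnAr ler_wpM2l ?(ltW c0)//.
  have h1 : (r ^ N <= (k N).+1 * (B * N.+1))%N.
    apply: (@leq_trans (r ^ N.+1 - r ^ N)); last first.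
      by apply: ltnW; apply: ltn_ceil; rewrite muln_gt0 hB.
    by rewrite expnS -{3}[(r ^ N)%N]mul1n -mulnBl leq_pmull// subn_gt0.
  have h2 : r%:R ^+ N <= ((k N)%:R + 1) * (B%:R * N.+1%:R) :> R.
    by rewrite natr1 -natrM -natrM -natrX ler_nat.
  have BN0 : 0 < B%:R * N.+1%:R :> R by rewrite mulr_gt0.
  have h3 : (B%:R * N.+1%:R)^-1 <= ((k N)%:R + 1) / r%:R ^+ N :> R.
    by rewrite ler_pdivlMr// mulrC ler_pdivrMr.
  have h4 : (r%:R ^+ N)^-1 <= (2%:R ^+ N)^-1 :> R.
    rewrite lef_pV2 ?posrE ?exprn_gt0// lerXn2r// ?nnegrE ?ler0n// ler_nat//.
  rewrite -[_ *+ k N]mulr_natl; move: h3; rewrite mulrDl mul1r => h3.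
  by rewrite lerBlDr (le_trans h3)// lerD2l.
apply: (@le_trans _ _
  (\sum_(N < n) c * ((B%:R * N.+1%:R)^-1 - (2%:R ^+ N)^-1))); last first.
  by apply: ler_sum => i _; exact: ha.
rewrite -mulr_sumr sumrB mulrC -ler_pdivrMr//.
under eq_bigr do rewrite invfM.
rewrite -mulr_sumr.
have h1 : M / c + 2 <= B%:R^-1 * \sum_(i < n) (i.+1%:R)^-1 :> R.
  by rewrite [leRHS]mulrC ler_pdivlMr// [leLHS]mulrC.
have := geometric_sum_le2 R n; lra.
Qed.

(** * Measurability of quantified conditions *)

Lemma measurable_exists d (T : measurableType d) (I : countType)
    (P : I -> T -> Prop) :
  (forall i, measurable [set x | P i x]) ->
  measurable [set x | exists i, P i x].
Proof.
move=> mP; rewrite [X in measurable X](_ : _ = \bigcup_i [set x | P i x]).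
  by apply: countable_bigcupT_measurable => //; exact: countableP.
by apply/seteqP; split=> x [i]; [exists i | move=> _ ?; exists i].
Qed.

Lemma measurable_forall d (T : measurableType d) (I : countType)
    (P : I -> T -> Prop) :
  (forall i, measurable [set x | P i x]) ->
  measurable [set x | forall i, P i x].
Proof.
move=> mP; rewrite -[X in measurable X]setCK; apply: measurableC.
rewrite [X in measurable X](_ : _ = [set x | exists i, ~ P i x]).
  by apply: measurable_exists => i; exact: measurableC (mP i).
by apply/seteqP; split=> x /=; [move/existsNP | move=> ? /=; exact/existsNP].
Qed.

Lemma measurable_imply d (T : measurableType d) (Q : Prop) (P : T -> Prop) :
  measurable [set x | P x] -> measurable [set x | Q -> P x].
Proof.
move=> mP; have [q|nq] := pselect Q.
  rewrite [X in measurable X](_ : _ = [set x | P x])//.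
  by apply/seteqP; split=> x /=; [exact|].
rewrite [X in measurable X](_ : _ = setT); first exact: measurableT.
by apply/seteqP; split=> x /=.
Qed.

(** Numerators are plain functions ['I_n -> int]; passing to finite functions makes the quantifier
    range over a countable type. *)
Lemma measurable_exists_ffun d (T : measurableType d) (n : nat)
    (P : ('I_n -> int) -> T -> Prop) :
  (forall p, measurable [set x | P p x]) ->
  measurable [set x | exists p, P p x].
Proof.
move=> mP.
rewrite [X in measurable X](_ : _ =
    [set x | exists p : {ffun 'I_n -> int}, P p x]).
  exact: measurable_exists.
apply/seteqP; split=> x [p Pp] /=; last by exists p.
by exists (finfun p); rewrite (_ : (finfun p : 'I_n -> int) = p)//;
  apply/funext => j; rewrite ffunE.
Qed.

Lemma measurable_forall_ffun d (T : measurableType d) (n : nat)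
    (P : ('I_n -> int) -> T -> Prop) :
  (forall p, measurable [set x | P p x]) ->
  measurable [set x | forall p, P p x].
Proof.
move=> mP; rewrite -[X in measurable X]setCK; apply: measurableC.
rewrite [X in measurable X](_ : _ = [set x | exists p, ~ P p x]).
  by apply: measurable_exists_ffun => p; exact: measurableC (mP p).
by apply/seteqP; split=> x /=; [move/existsNP | move=> ? /=; exact/existsNP].
Qed.

(** * Borel sets and continuous maps of ['rV[R]_n] *)

Section borel.
Context (R : realType) (n : nat).

Lemma closed_measurable_rV (A : set 'rV[R]_n) :
  closed A -> measurable (A : set (borelRn R n)).
Proof.
move=> cA; rewrite -[A]setCK; apply: measurableC; apply: sub_sigma_algebra.
exact: closed_openC.
Qed.

Lemma continuous_measurable_rV (f : 'rV[R]_n -> 'rV[R]_n) :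
  continuous f -> measurable_fun setT (f : borelRn R n -> borelRn R n).
Proof.
move=> cf; apply: (@measurability _ _ (borelRn R n) (borelRn R n) setT f
  (@open 'rV[R]_n : set (set 'rV[R]_n)) erefl).
move=> _ [B oB <-]; rewrite setTI; apply: sub_sigma_algebra.
by move/continuousP: cf; apply.
Qed.

Lemma continuous_dist_coord (j : 'I_n) (v : R) :
  continuous (fun x : 'rV[R]_n => `|x 0 j - v|).
Proof.
move=> x.
apply: (@continuous_comp _ _ _ (fun x : 'rV[R]_n => x 0 j - v) Num.norm).
  apply: (@continuousB _ _ _ (fun x : 'rV[R]_n => x 0 j) (cst v)).
    exact: coord_continuous.
  exact: cst_continuous.
exact: norm_continuous.
Qed.

Lemma closed_dist_coord (j : 'I_n) (v e : R) :
  closed [set x : 'rV[R]_n | `|x 0 j - v| <= e].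
Proof.
rewrite (_ : mkset _ =
  (fun x : 'rV[R]_n => `|x 0 j - v|) @^-1` [set y | y <= e])//.
have /continuous_closedP := @continuous_dist_coord j v.
by apply; exact: closed_le.
Qed.

Lemma closed_far_coord (j : 'I_n) (v e : R) :
  closed [set x : 'rV[R]_n | e <= `|x 0 j - v| ].
Proof.
rewrite (_ : mkset _ =
  (fun x : 'rV[R]_n => `|x 0 j - v|) @^-1` [set y | e <= y])//.
have /continuous_closedP := @continuous_dist_coord j v.
by apply; exact: closed_ge.
Qed.

Lemma continuous_prod_map (r : nat) (i : {ffun 'I_n -> 'I_r}) :
  continuous (@prod_map R r n i).
Proof.
rewrite (_ : @prod_map R r n i =
    fun x => r%:R^-1 *: (x + \row_j (i j)%:R)); last first.
  by apply/funext => x; apply/rowP => j; rewrite !mxE /digit_map mulrC.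
move=> x.
apply: (@continuousZl_tmp R 'rV[R]_n 'rV[R]_n
  (fun x => x + \row_j (i j)%:R) r%:R^-1 x).
by apply: continuousD => //; exact: cst_continuous.
Qed.

Lemma closed_prod_set (K : 'I_n -> set R) :
  (forall j, closed (K j)) -> closed (prod_set K).
Proof.
move=> cK.
rewrite (_ : prod_set K =
  \bigcap_(j in [set: 'I_n]) ((fun x : 'rV[R]_n => x 0 j) @^-1` K j)).
  apply: closed_bigI => j _.
  have := @coord_continuous R 1 n 0 j.
  by move/continuous_closedP; apply.
by apply/seteqP; split => x /=; [move=> + j _; exact | move=> + j; exact].
Qed.

End borel.

(** * Attractors on the line *)

Section attractor.
Context (R : realType) (r : nat) (D : {set 'I_r}) (K : set R).
Context (hr : (2 <= r)%N).
Context (hK : is_attractor D K).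

Lemma attractor_digit_map (a : 'I_r) (x : R) :
  a \in D -> K x -> K (digit_map a x).
Proof.
by case: hK => _ _ _ K_eq aD Kx; rewrite K_eq; exists a => //; exists x.
Qed.

Lemma attractor_closed : closed K.
Proof. by case: hK => _ + _ _; apply: compact_closed; exact: Rhausdorff. Qed.

Lemma attractor_digits_neq0 : (0 < #|D|)%N.
Proof.
case: hK => -[x Kx] _ _ K_eq.
move: Kx; rewrite K_eq => -[a aD _].
by rewrite card_gt0; apply/set0Pn; exists a.
Qed.

(** By compactness some point of [K] is nearest to [z], the fixed point of [digit_map a]. That map
    keeps [K] stable and divides the distance to [z] by [r], so the minimal distance is 0. *)
Lemma attractor_fixed_point (a : 'I_r) : a \in D -> K (a%:R / (r - 1)%:R).
Proof.
move=> aD; set z := _ / _.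
have r0 : r%:R != 0 :> R by rewrite pnatr_eq0; case: (r) hr.
have fz (x : R) : digit_map a x - z = (x - z) / r%:R.
  rewrite /z /digit_map natrB ?(ltnW hr)//; field; rewrite r0 /=.
  by rewrite subr_eq0 pnatr_eq1; case: (r) hr => [|[]].
case: hK => -[x0 Kx0] cK _ _.
have cd : {within K, continuous (fun x : R => `|x - z|)}.
  apply: continuous_subspaceT => x.
  apply: (@continuous_comp _ _ _ (fun x : R => x - z) Num.norm).
    by apply: continuousB => //; exact: cst_continuous.
  exact: norm_continuous.
have [x /set_mem Kx xmin] := compact_EVT_min (ex_intro _ x0 Kx0) cK cd.
have := xmin _ (mem_set (attractor_digit_map aD Kx)).
rewrite fz normrM normfV normr_nat.
have r2 : 2 <= r%:R :> R by rewrite ler_nat.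
rewrite ler_pdivlMr ?(lt_le_trans _ r2)// => h.
suff /eqP : `|x - z| = 0 by rewrite normr_eq0 subr_eq0 => /eqP <-.
by have := normr_ge0 (x - z); nra.
Qed.

End attractor.

(* [r ^ m * (r - 1)] is a denominator of the points whose digits are constant
   from position [m] on. *)
Definition near_rational (R : realType) (r n : nat) (K : set 'rV[R]_n)
    (m : nat) (l : 'I_n -> nat) : set 'rV[R]_n :=
  [set x | exists p : 'I_n -> int,
    K (rational_point R p (r ^ m * (r - 1))) /\
    forall j, `|x 0 j - (p j)%:~R / (r ^ m * (r - 1))%:R|
              <= (r%:R ^+ (m + l j))^-1].

(** [a j / (r - 1)] is the fixed point of [digit_map (a j)], with all base [r] digits equal to
    [a j]. Closeness to it replaces the condition that the expansion starts with [l j] digits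
    [a j]. *)
Definition near_fixed (R : realType) (r n : nat) (a : {ffun 'I_n -> 'I_r})
    (l : 'I_n -> nat) : set 'rV[R]_n :=
  [set x | forall j, `|x 0 j - (a j)%:R / (r - 1)%:R| <= (r%:R ^+ l j)^-1].

Lemma measurable_near_rational (R : realType) (r n : nat) (K : set 'rV[R]_n)
    (m : nat) (l : 'I_n -> nat) :
  measurable (near_rational r K m l : set (borelRn R n)).
Proof.
apply: measurable_exists_ffun => p.
have [Kp|nKp] := pselect (K (rational_point R p (r ^ m * (r - 1)))).
  rewrite [X in measurable X](_ : _ = [set x : borelRn R n | forall j : 'I_n,
    `|x 0 j - (p j)%:~R / (r ^ m * (r - 1))%:R| <= (r%:R ^+ (m + l j))^-1]).
    apply: measurable_forall => j; apply: closed_measurable_rV.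
    exact: closed_dist_coord.
  by apply/seteqP; split=> x /=; [case|split].
by rewrite [X in measurable X](_ : _ = set0)//; apply/seteqP; split=> x //= [].
Qed.

Lemma measurable_near_fixed (R : realType) (r n : nat)
    (a : {ffun 'I_n -> 'I_r}) (l : 'I_n -> nat) :
  measurable (near_fixed a l : set (borelRn R n)).
Proof.
apply: measurable_forall => j; apply: closed_measurable_rV.
exact: closed_dist_coord.
Qed.

(** * The product attractor under its digit maps *)

Section cantor_product.
Context (R : realType) (r n : nat) (D : 'I_n -> {set 'I_r}) (K : 'I_n -> set R).
Context (hr : (2 <= r)%N).
Context (hK : forall j, is_attractor (D j) (K j)).

Let r0 : r%:R != 0 :> R.
Proof. by rewrite pnatr_eq0; case: (r) hr. Qed.

Let r_gt0 : 0 < r%:R :> R.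
Proof. by rewrite ltr0n; case: (r) hr. Qed.

Let r1 : (r - 1)%:R != 0 :> R.
Proof. by rewrite pnatr_eq0 -lt0n subn_gt0. Qed.

Lemma mem_prod_digits (i : {ffun 'I_n -> 'I_r}) (j : 'I_n) :
  i \in prod_digits D -> i j \in D j.
Proof. by rewrite inE => /forallP. Qed.

Lemma prod_set_prod_map (i : {ffun 'I_n -> 'I_r}) (x : 'rV[R]_n) :
  i \in prod_digits D -> prod_set K x -> prod_set K (prod_map i x).
Proof.
move=> iD Kx j; rewrite mxE.
exact: (attractor_digit_map (hK j) (mem_prod_digits j iD) (Kx j)).
Qed.

(** Prepending a digit multiplies the denominator by [r] and divides the error by [r], so only the
    position moves. *)
Lemma near_rational_prod_map (i : {ffun 'I_n -> 'I_r}) (m : nat)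
    (l : 'I_n -> nat) (x : 'rV[R]_n) : i \in prod_digits D ->
  near_rational r (prod_set K) m l x ->
  near_rational r (prod_set K) m.+1 l (prod_map i x).
Proof.
move=> iD [p [Kp xp]].
have hq : r%:R ^+ m != 0 :> R by rewrite expf_neq0.
(* The new numerator comes from [(p / q + a) / r = (p + a * q) / (r * q)]. *)
have fp j : (p j + (i j * (r ^ m * (r - 1)))%N%:Z)%:~R / (r ^ m.+1 * (r - 1))%:R
    = digit_map (i j) ((p j)%:~R / (r ^ m * (r - 1))%:R) :> R.
  rewrite /digit_map intrD expnS -pmulrn !natrM !natrX; field.
  by rewrite r0 hq r1.
exists (fun j => p j + (i j * (r ^ m * (r - 1)))%N%:Z); split.
  rewrite (_ : rational_point _ _ _ =
      prod_map i (rational_point R p (r ^ m * (r - 1)))).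
    exact: prod_set_prod_map.
  by apply/rowP => j; rewrite !mxE fp.
move=> j; rewrite fp mxE /digit_map -mulrBl opprD addrACA subrr addr0.
by rewrite normrM normfV normr_nat addSn exprS invfM mulrC ler_pM2l ?invr_gt0.
Qed.

Lemma near_fixed_near_rational (a : {ffun 'I_n -> 'I_r}) (l : 'I_n -> nat)
    (x : 'rV[R]_n) : a \in prod_digits D ->
  near_fixed a l x -> near_rational r (prod_set K) 0 l x.
Proof.
move=> aD hx; exists (fun j => (a j)%:Z); rewrite expn0 mul1n; split.
  move=> j; rewrite mxE -pmulrn.
  exact: (attractor_fixed_point hr (hK j) (mem_prod_digits j aD)).
by move=> j; rewrite -pmulrn; exact: hx.
Qed.

Lemma near_fixed0 (a : {ffun 'I_n -> 'I_r}) (l : 'I_n -> nat) (j : 'I_n)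
    (x : 'rV[R]_n) : a \in prod_digits D -> prod_set K x -> l j = 0%N ->
  `|x 0 j - (a j)%:R / (r - 1)%:R| <= (r%:R ^+ l j)^-1.
Proof.
move=> aD Kx ->; rewrite expr0 invr1.
have [_ _ K01 _] := hK j.
have := K01 _ (attractor_fixed_point hr (hK j) (mem_prod_digits j aD)).
have := K01 _ (Kx j); rewrite /= !in_itv /= => /andP[? ?] /andP[? ?].
by rewrite ler_norml; apply/andP; split; lra.
Qed.

(** Where a run is pending, the prepended digit contracts towards the fixed point by [r]; where
    [l j = 0], the bound is 1 and both points lie in the unit interval. *)
Lemma near_fixed_prod_map (a i : {ffun 'I_n -> 'I_r}) (l : 'I_n -> nat)
    (x : 'rV[R]_n) : a \in prod_digits D -> i \in prod_digits D ->
  prod_set K x -> (forall j, (0 < l j)%N -> i j = a j) ->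
  near_fixed a (fun j => (l j).-1) x -> near_fixed a l (prod_map i x).
Proof.
move=> aD iD Kx ia hx j; have [lj0|lj0] := posnP (l j).
  by apply: near_fixed0 => //; exact: prod_set_prod_map.
have := hx j; rewrite mxE (ia j)// -{2}(prednK lj0) exprS invfM.
rewrite -(@ler_pM2l _ r%:R^-1) ?invr_gt0//.
rewrite -[X in X * `|_|](@ger0_norm _ r%:R^-1) ?invr_ge0 ?ler0n// -normrM.
congr (`|_| <= _); rewrite /digit_map natrB ?(ltnW hr)//; field.
by rewrite r0 /= subr_eq0 pnatr_eq1; case: (r) hr => [|[]].
Qed.

Lemma prod_digits_neq0 : exists a, a \in prod_digits D.
Proof.
have h j : exists d, d \in D j.
  by apply/set0Pn; rewrite -card_gt0; exact: attractor_digits_neq0 (hK j).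
have [a ha] := choice h.
by exists (finfun a); rewrite inE; apply/forallP => j; rewrite ffunE.
Qed.

Lemma closed_attractor_prod : closed (prod_set K).
Proof. by apply: closed_prod_set => j; exact: attractor_closed (hK j). Qed.

(** The reciprocal of the number of product digits, written as a product so that it factors over the
    coordinates. *)
Definition uniform_weight : R := (\prod_j #|D j|%:R)^-1.

Lemma uniform_weight_ge0 : 0 <= uniform_weight.
Proof. by rewrite invr_ge0 prodr_ge0. Qed.

Lemma powR_digit_dim (j : 'I_n) : r%:R `^ digit_dim R (D j) = #|D j|%:R.
Proof.
have D0 := attractor_digits_neq0 (hK j).
have lr : ln r%:R != 0 :> R by rewrite gt_eqF// ln_gt0// ltr1n.
by rewrite /powR (negbTE r0) /digit_dim divfK// lnK// posrE ltr0n.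
Qed.

Lemma powR_prod_dim : r%:R `^ (- prod_dim R D) = uniform_weight.
Proof.
rewrite powRN /uniform_weight; congr _^-1.
rewrite -(eq_bigr _ (fun j _ => powR_digit_dim j)) /prod_dim.
elim/big_rec2: _ => [|j x y _ <-]; first by rewrite powRr0.
by rewrite powRD// r0 implybT.
Qed.

(** Distributivity; it expresses that the digits of different coordinates are chosen
    independently. *)
Lemma sum_prod_digits (e : 'I_n -> 'I_r -> R) :
  \sum_(i in prod_digits D) \prod_j e j (i j) = \prod_j \sum_(d in D j) e j d.
Proof.
rewrite bigA_distr_big_dep; apply: eq_bigl => i.
rewrite inE; apply/forallP/familyP => h j; exact: h.
Qed.

Lemma uniform_weight_sum1 : uniform_weight * \sum_(i in prod_digits D) 1 = 1.
Proof.
have -> : \sum_(i in prod_digits D) 1 = \prod_j #|D j|%:R :> R.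
  rewrite [RHS](eq_bigr (fun j => \sum_(d in D j) 1)); last first.
    by move=> j _; rewrite sumr_const.
  rewrite -(sum_prod_digits (fun _ _ => 1)).
  by apply: eq_bigr => i _; rewrite big1.
rewrite /uniform_weight mulVf//; apply/prodf_neq0 => j _.
by rewrite pnatr_eq0 -lt0n (attractor_digits_neq0 (hK j)).
Qed.

(* The probability of starting with [l j] digits [a j] for all [j], split into
   the first digit and the remaining ones. *)
Lemma uniform_weight_match (a : {ffun 'I_n -> 'I_r}) (l : 'I_n -> nat) :
  a \in prod_digits D ->
  uniform_weight *
    (\sum_(i in prod_digits D) \prod_j ((0 < l j)%N ==> (i j == a j))%:R)
    * (\prod_j #|D j|%:R ^+ (l j).-1)^-1 = (\prod_j #|D j|%:R ^+ l j)^-1 .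
Proof.
move=> aD.
rewrite (sum_prod_digits (fun j d => ((0 < l j)%N ==> (d == a j))%:R)).
rewrite /uniform_weight -!prodfV -!big_split /=; apply: eq_bigr => j _.
have D0 : #|D j|%:R != 0 :> R.
  by rewrite pnatr_eq0 -lt0n (attractor_digits_neq0 (hK j)).
have [lj0|lj0] := posnP (l j).
  rewrite lj0 /= expr0 invr1 mulr1 (eq_bigr (fun _ => 1))//.
  by rewrite sumr_const mulVf.
rewrite -[in RHS](prednK lj0) exprS invfM.
rewrite (bigD1 (a j)) ?(mem_prod_digits j aD)//= eqxx big1 ?addr0 ?mulr1//.
by move=> d /andP[_ /negbTE ->].
Qed.

(** * Estimates for the self-similar measure *)

Section measure.
Context (mu : probability (borelRn R n) R).
Context (hmu : is_canonical_measure D (prod_set K) mu).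

Lemma measure_fin (A : set (borelRn R n)) : measurable A ->
  0 <= fine (mu A) <= 1.
Proof.
move=> mA; rewrite fine_ge0 ?measure_ge0//=.
by rewrite -lee_fin fineK ?probability_le1// fin_num_measure.
Qed.

Lemma measurable_attractor_prod :
  measurable (prod_set K : set (borelRn R n)).
Proof. exact: closed_measurable_rV closed_attractor_prod. Qed.

Lemma measure_disjoint_attractor (A : set (borelRn R n)) : measurable A ->
  (forall x, prod_set K x -> ~ A x) -> fine (mu A) = 0.
Proof.
move=> mA AK; suff -> : mu A = 0%E by [].
apply: (@subset_measure0 _ _ _ mu A (~` prod_set K)) => //.
- exact: measurableC measurable_attractor_prod.
- by move=> x Ax Kx; exact: AK Kx Ax.
- by case: hmu.
Qed.

(** The complement of the attractor is null, so the preimage of [A] need only lie in [B i] on the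
    attractor. *)
Lemma measure_self_similar_le (A : set (borelRn R n))
    (B : {ffun 'I_n -> 'I_r} -> set (borelRn R n)) :
  measurable A -> (forall i, measurable (B i)) ->
  (forall i x, i \in prod_digits D -> prod_set K x ->
     A (prod_map i x) -> B i x) ->
  fine (mu A) <= uniform_weight * \sum_(i in prod_digits D) fine (mu (B i)).
Proof.
move=> mA mB AB; have [muK ->//] := hmu.
have mP i : measurable (@prod_map R r n i @^-1` A : set (borelRn R n)).
  rewrite -[X in measurable X]setTI.
  have := continuous_measurable_rV (@continuous_prod_map R n r i).
  by move=> /(_ measurableT _ mA).
rewrite powR_prod_dim.
rewrite (eq_bigr (fun i =>
    (uniform_weight * fine (mu (@prod_map R r n i @^-1` A)))%:E)); last first.
  by move=> i _; rewrite EFinM fineK// fin_num_measure.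
rewrite sumEFin /= -mulr_sumr ler_wpM2l ?uniform_weight_ge0//.
apply: ler_sum => i iD.
have mK := measurableC measurable_attractor_prod.
apply: fine_le; rewrite ?fin_num_measure//.
rewrite -(measureU0 (mB i) mK muK); apply: le_measure; rewrite ?inE//.
  exact: measurableU.
move=> x Ax; have [Kx|nKx] := pselect (prod_set K x); last by right.
by left; exact: AB Ax.
Qed.

Lemma measure_shift_le (A B : set (borelRn R n)) :
  measurable A -> measurable B ->
  (forall i x, i \in prod_digits D -> prod_set K x ->
     A (prod_map i x) -> B x) ->
  fine (mu A) <= fine (mu B).
Proof.
move=> mA mB AB.
apply: le_trans (measure_self_similar_le (B := fun=> B) mA (fun=> mB) AB) _.
rewrite -[X in \sum_(_ in _) X]mul1r -mulr_suml mulrA.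
by rewrite uniform_weight_sum1 mul1r.
Qed.

(** [X t] stands for an event read after the first [t] digits, hence independent of a run within the
    first [L]. The induction peels off one digit: if it agrees with every pending run, the runs
    shorten by one; otherwise [X L] is bounded by [X 0]. *)
Lemma measure_window_le (a : {ffun 'I_n -> 'I_r})
    (X : nat -> set (borelRn R n)) (L : nat) (l : 'I_n -> nat) :
  a \in prod_digits D -> (forall t, measurable (X t)) ->
  (forall t i x, i \in prod_digits D -> prod_set K x ->
     X t.+1 (prod_map i x) -> X t x) ->
  (forall j, (l j <= L)%N) ->
  fine (mu (X L `\` near_fixed a l))
    <= (1 - (\prod_j #|D j|%:R ^+ l j)^-1) * fine (mu (X 0%N)).
Proof.
move=> aD mX hX.
have mXa t m : measurable (X t `\` near_fixed a m : set (borelRn R n)).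
  by apply: measurableD => //; exact: measurable_near_fixed.
have X0 t : fine (mu (X t)) <= fine (mu (X 0%N)).
  elim: t => // t; apply: le_trans; apply: measure_shift_le => // i x.
  exact: hX.
elim: L l => [|L IH] l hl.
  (* With all runs empty, every point of the attractor is in [near_fixed a l], and the factor on the
     right is [1 - 1]. *)
  rewrite measure_disjoint_attractor//; last first.
    move=> x Kx [_]; apply => j; apply: near_fixed0 => //.
    by apply/eqP; rewrite -leqn0.
  have l0 j : l j = 0%N by apply/eqP; rewrite -leqn0.
  by rewrite big1 ?invr1 ?subrr ?mul0r// => j _; rewrite l0 expr0.
pose agree (i : {ffun 'I_n -> 'I_r}) :=
  [forall j, (0 < l j)%N ==> (i j == a j)].
pose B i := if agree i then X L `\` near_fixed a (fun j => (l j).-1) else X L.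
apply: le_trans (measure_self_similar_le (B := B) _ _ _) _ => //.
- by move=> i; rewrite /B; case: ifP.
- move=> i x iD Kx [XL nf]; rewrite /B; case: ifPn => [/forallP mi|_].
    split; first exact: hX XL.
    move=> h; apply: nf; apply: near_fixed_prod_map => // j lj.
    by have := mi j; rewrite lj /= => /eqP.
  exact: hX XL.
set P := (\prod_j _ ^+ _)^-1; set P' := (\prod_j #|D j|%:R ^+ (l j).-1)^-1 : R.
(* The product of indicators is 1 or 0 according to [agree i], so both cases share one formula that
   can be averaged over [i]. *)
have hB i : fine (mu (B i)) <=
    fine (mu (X 0%N)) - \prod_j ((0 < l j)%N ==> (i j == a j))%:R
                         * (P' * fine (mu (X 0%N))).
  rewrite /B; case: ifPn => [/forallP mi|].
    rewrite big1 => [|j _]; last by rewrite (mi j).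
    rewrite mul1r -{1}[fine (mu (X 0%N))]mul1r -mulrBl; apply: IH => j.
    by rewrite -subn1 leq_subLR add1n.
  rewrite negb_forall => /existsP[j /negbTE nj].
  by rewrite (bigD1 j)//= nj !mul0r subr0.
apply: (@le_trans _ _ (uniform_weight * \sum_(i in prod_digits D)
  (fine (mu (X 0%N)) - \prod_j ((0 < l j)%N ==> (i j == a j))%:R
                         * (P' * fine (mu (X 0%N)))))).
  by rewrite ler_wpM2l ?uniform_weight_ge0//; apply: ler_sum => i _; exact: hB.
rewrite sumrB mulrBr -mulr_suml mulrBl mul1r.
rewrite -{1}[fine (mu (X 0%N))]mul1r -mulr_suml mulrA uniform_weight_sum1 mul1r.
by rewrite !mulrA uniform_weight_match.
Qed.

End measure.

End cantor_product.

(** * Badly approximable points with a fixed constant *)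

Definition Bad_const (R : realType) (n : nat) (K : set 'rV[R]_n)
    (tau : 'I_n -> R) (c : R) : set 'rV[R]_n :=
  [set x | K x /\ forall (p : 'I_n -> int) (q : nat), (1 < q)%N ->
      K (rational_point R p q) ->
      exists i, c / (q%:R * ln q%:R `^ tau i)
                <= `|x 0 i - (p i)%:~R / q%:R| ].

Lemma Bad_IntE (R : realType) (n : nat) (K : set 'rV[R]_n) (tau : 'I_n -> R) :
  Bad_Int K tau = \bigcup_k Bad_const K tau k.+1%:R^-1.
Proof.
apply/seteqP; split=> x; last first.
  by move=> [k _ [Kx bx]]; split => //; exists k.+1%:R^-1.
(* The condition weakens as the constant decreases, and this index makes the new constant smaller
   than [c]. *)
move=> [Kx [c c0 bx]]; exists (Num.truncn c^-1) => //; split => // p q q1 Kp.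
have [i hi] := bx p q q1 Kp; exists i; apply: le_trans hi.
rewrite ler_wpM2r//.
  by rewrite invr_ge0 mulr_ge0 ?ler0n ?powR_ge0.
rewrite -[leRHS]invrK lef_pV2 ?posrE ?invr_gt0// ltW//.
exact: truncnS_gt.
Qed.

Lemma measurable_Bad_const (R : realType) (n : nat) (K : set 'rV[R]_n)
    (tau : 'I_n -> R) (c : R) :
  closed K -> measurable (Bad_const K tau c : set (borelRn R n)).
Proof.
move=> cK; apply: measurableI; first exact: closed_measurable_rV.
apply: measurable_forall_ffun => p; apply: measurable_forall => q.
apply: measurable_imply; apply: measurable_imply; apply: measurable_exists => i.
by apply: closed_measurable_rV; exact: closed_far_coord.
Qed.

(** [trunc_log r m + 2] bounds the base [r] logarithm of [ln q]. [C] absorbs the constant of bad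
    approximability; of the final 2, one offsets the truncation and one the bound
    [q <= r ^ m.+1]. *)
Definition window_length (R : realType) (r n : nat) (tau : 'I_n -> R)
    (C m : nat) (j : 'I_n) : nat :=
  (C + (Num.truncn (tau j * (trunc_log r m).+2%:R)).+2)%N.

(** * Window lengths, their approximation quality and their probability *)

Section badly_approximable.
Context (R : realType) (r n : nat) (D : 'I_n -> {set 'I_r}) (K : 'I_n -> set R).
Context (hr : (2 <= r)%N).
Context (hK : forall j, is_attractor (D j) (K j)).
Context (tau : 'I_n -> R).
Context (htau : forall i, 0 < tau i).
Context (hsum : \sum_(i < n) tau i * digit_dim R (D i) = 1).

Let r0 : r%:R != 0 :> R.
Proof. by rewrite pnatr_eq0; case: (r) hr. Qed.

Let r_gt0 : 0 < r%:R :> R.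
Proof. by rewrite ltr0n; case: (r) hr. Qed.

Let r_ge1 : 1 <= r%:R :> R.
Proof. by rewrite ler1n; case: (r) hr. Qed.

Lemma window_length_ge (C m : nat) (j : 'I_n) :
  C%:R + 1 + tau j * (trunc_log r m).+2%:R <= (window_length r tau C m j)%:R.
Proof.
rewrite /window_length (natrD _ C) -addrA lerD2l.
rewrite -[X in _ <= X]natr1 addrC lerD2r.
by apply: ltW; exact: truncnS_gt.
Qed.

Lemma window_length_le (C m : nat) (j : 'I_n) :
  (window_length r tau C m j)%:R <= C%:R + 2 + tau j * (trunc_log r m).+2%:R.
Proof.
rewrite /window_length (natrD _ C) -addrA lerD2l -[X in X%:R <= _]addn2.
rewrite (natrD _ (Num.truncn _)) [leRHS]addrC lerD2r.
by rewrite truncn_le mulr_ge0// ltW.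
Qed.

Lemma digit_dim_ge0 (j : 'I_n) : 0 <= digit_dim R (D j).
Proof.
by rewrite divr_ge0 ?ln_ge0// ler1n (attractor_digits_neq0 (hK j)).
Qed.

(** The logarithm is at most [m.+1 * ln r], where [m.+1 <= r ^ (trunc_log r m).+1] and
    [ln r <= r]. *)
Lemma ln_denominator_le (m : nat) :
  ln (r ^ m * (r - 1))%:R <= r%:R ^+ (trunc_log r m).+2 :> R.
Proof.
have q0 : (0 < r ^ m * (r - 1))%N.
  by rewrite muln_gt0 expn_gt0 (ltnW hr) subn_gt0.
apply: (@le_trans _ _ (ln (r%:R ^+ m.+1))).
  rewrite ler_ln ?posrE ?ltr0n ?exprn_gt0// -natrX ler_nat expnSr.
  by rewrite leq_mul2l leq_subr orbT.
rewrite lnXn// -[_ *+ m.+1]mulr_natl exprSr ler_pM//.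
- by rewrite ln_ge0.
- by rewrite -natrX ler_nat trunc_log_ltn.
- by apply: ltW; exact: ln_sublinear.
Qed.

(** With [w] the power of [ln q] and [l] the window length, [q * w * r ^ C <= r ^ (m + l)]. Since
    [c * r ^ C > 1], the error [r ^ - (m + l)] is below [c / (q * w)] in every coordinate. *)
Lemma near_rational_not_Bad (C m : nat) (c : R) (x : 'rV[R]_n) :
  (0 < m)%N -> 1 < c * r%:R ^+ C ->
  near_rational r (prod_set K) m (window_length r tau C m) x ->
  ~ Bad_const (prod_set K) tau c x.
Proof.
move=> m0 hc [p [Kp hp]] [_ bx].
set q := (r ^ m * (r - 1))%N in Kp hp bx.
have q1 : (1 < q)%N.
  apply: (@leq_trans (r ^ m)); last by rewrite leq_pmulr// subn_gt0.
  by rewrite (leq_trans hr)// -{1}(expn1 r) leq_exp2l.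
have [i hi] := bx p q q1 Kp.
have := le_trans hi (hp i); apply/negP; rewrite -ltNge.
set l := window_length r tau C m i.
have q0 : 0 < q%:R :> R by rewrite ltr0n (ltnW q1).
have lnq0 : 0 < ln q%:R :> R by rewrite ln_gt0// ltr1n.
have c0 : 0 < c.
  rewrite ltNge; apply/negP => c0.
  have : c * r%:R ^+ C <= 0 by rewrite mulr_le0_ge0// exprn_ge0// ltW.
  lra.
set w := ln q%:R `^ tau i.
have w0 : 0 < w by rewrite powR_gt0.
have hq : q%:R <= r%:R ^+ m.+1 :> R.
  by rewrite -natrX ler_nat expnSr leq_mul2l leq_subr orbT.
have hw : w * r%:R ^+ C.+1 <= r%:R ^+ l.
  apply: (@le_trans _ _
    (r%:R `^ (tau i * (trunc_log r m).+2%:R) * r%:R ^+ C.+1)).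
    rewrite ler_wpM2r ?exprn_ge0 ?(ltW r_gt0)//.
    rewrite mulrC powRrM powR_mulrn ?(ltW r_gt0)//.
    apply: ge0_ler_powR; rewrite ?nnegrE ?exprn_ge0 ?(ltW r_gt0)//.
    - exact: ltW.
    - exact: ltW.
    - exact: ln_denominator_le.
  rewrite -!powR_mulrn ?(ltW r_gt0)// -powRD ?r0 ?implybT//.
  apply: ler_powR => //; rewrite addrC -natr1; exact: window_length_ge.
have qw0 : 0 < q%:R * w by rewrite mulr_gt0.
rewrite ltr_pdivlMr// mulrC ltr_pdivrMr ?exprn_gt0//.
apply: (@lt_le_trans _ _ (q%:R * w * (c * r%:R ^+ C))).
  by rewrite -[X in X < _]mulr1 ltr_pM2l.
rewrite mulrCA ler_pM2l//.
rewrite -(@ler_pM2l _ r%:R)//.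
have -> : r%:R * (q%:R * w * r%:R ^+ C) = q%:R * (w * r%:R ^+ C.+1) :> R.
  by rewrite exprS; ring.
rewrite exprD [leRHS]mulrA -exprS; apply: ler_pM => //.
by rewrite mulr_ge0 ?exprn_ge0 ?ltW.
Qed.

(** As [#|D j|] is [r] to the power [digit_dim R (D j)], the product is a power of [r]. By [hsum]
    its exponent grows like [trunc_log r m] with coefficient exactly 1, the borderline for
    divergence. *)
Lemma agreeprobability_ge (C m : nat) :
  r%:R `^ (- ((C%:R + 2) * prod_dim R D + 2)) / r%:R ^+ trunc_log r m
    <= (\prod_j #|D j|%:R ^+ window_length r tau C m j)^-1.
Proof.
set l := window_length r tau C m; set N := trunc_log r m.
have D0 j : 0 < #|D j|%:R :> R by rewrite ltr0n (attractor_digits_neq0 (hK j)).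
rewrite powRN -invfM.
rewrite lef_pV2 ?posrE ?mulr_gt0 ?powR_gt0 ?exprn_gt0//; last first.
  by rewrite prodr_gt0// => j _; rewrite exprn_gt0.
have -> : \prod_j #|D j|%:R ^+ l j =
    r%:R `^ (\sum_j digit_dim R (D j) * (l j)%:R).
  elim/big_rec2: _ => [|j y z _ ->]; first by rewrite powRr0.
  rewrite powRD ?r0 ?implybT// powRrM powR_mulrn ?powR_ge0//.
  by rewrite (powR_digit_dim hr hK).
rewrite -powR_mulrn ?(ltW r_gt0)// -powRD ?r0 ?implybT//.
apply: ler_powR => //.
apply: (@le_trans _ _ (\sum_j ((C%:R + 2) * digit_dim R (D j)
           + (tau j * digit_dim R (D j)) * N.+2%:R))).
  apply: ler_sum => j _.
  apply: le_trans (ler_wpM2l (digit_dim_ge0 j) (window_length_le C m j)) _.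
  by rewrite le_eqVlt; apply/orP; left; apply/eqP; rewrite /N; ring.
rewrite big_split /= -mulr_sumr.
have -> : \sum_j tau j * digit_dim R (D j) * N.+2%:R = N.+2%:R.
  by rewrite -mulr_suml hsum mul1r.
rewrite -addrA lerD2l.
by rewrite -addn2 natrD addrC.
Qed.

Lemma window_length_linear (C : nat) : exists2 B : nat, (0 < B)%N &
  forall m j, (window_length r tau C m j <= B * (trunc_log r m).+1)%N.
Proof.
(* Obtained from [tau j <= \sum_j tau j] and [N + 2 <= 2 * (N + 1)]. *)
pose T : R := C%:R + 2 + 2 * \sum_j tau j.
exists (Num.truncn T).+1 => // m j.
have tj : tau j <= \sum_j tau j.
  by rewrite (bigD1 j)//= lerDl sumr_ge0// => i _; exact: ltW.
rewrite -(ler_nat R) natrM; apply: le_trans (window_length_le C m j) _.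
move: (trunc_log r m) => N.
apply: (@le_trans _ _ (T * N.+1%:R)); last first.
  by rewrite ler_wpM2r// ltW//; exact: truncnS_gt.
have N0 : 0 <= N%:R :> R by [].
have C0 : 0 <= C%:R :> R by [].
have := htau j; rewrite /T -[N.+2%:R]natr1 -[N.+1%:R]natr1 => tj0.
have h1 : tau j * (N%:R + 1 + 1) <= (\sum_j tau j) * (2 * (N%:R + 1)).
  by apply: ler_pM => //; [exact: ltW|lra].
have h2 : 0 <= (C%:R + 2) * N%:R :> R by rewrite mulr_ge0// addr_ge0.
move: h1 h2; set S := \sum_j _ => h1 h2; lra.
Qed.

(* The window attached to position [s + m] of the expansion of a point is sought
   after dropping the first [s - t] digits. *)
Definition avoid (C s t : nat) : set 'rV[R]_n :=
  [set x | prod_set K x /\ forall m : nat,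
    ~ near_rational r (prod_set K) (m + t) (window_length r tau C (s + m)) x].

Lemma measurable_avoid (C s t : nat) :
  measurable (avoid C s t : set (borelRn R n)).
Proof.
apply: measurableI; first exact: measurable_attractor_prod hK.
apply: measurable_forall => m.
exact: measurableC (measurable_near_rational _ _ _ _).
Qed.

(** * Vanishing measure for a fixed constant *)

Context (mu : probability (borelRn R n) R).
Context (hmu : is_canonical_measure D (prod_set K) mu).

Lemma measure_Bad_const_eq0 (c : R) : 0 < c ->
  fine (mu (Bad_const (prod_set K) tau c)) = 0.
Proof.
move=> c0; have [C hC] : exists C : nat, 1 < c * r%:R ^+ C.
  exists (Num.truncn c^-1).+1; rewrite mulrC -ltr_pdivrMr// mul1r.
  apply: (lt_trans (truncnS_gt c^-1)).
  by rewrite -natrX ltr_nat ltn_expl.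
have [B B0 hB] := window_length_linear C.
pose u s := fine (mu (avoid C s 0)).
have mBad : measurable (Bad_const (prod_set K) tau c : set (borelRn R n)).
  exact: measurable_Bad_const (closed_attractor_prod hK).
have Bu : fine (mu (Bad_const (prod_set K) tau c)) <= u 1%N.
  (* One digit is dropped, so only positive positions occur, as [near_rational_not_Bad] requires. *)
  apply: (measure_shift_le hr hK hmu) => //; first exact: measurable_avoid.
  move=> i x iD Kx Bx; split=> // m; rewrite addn0 add1n => nx.
  apply: (near_rational_not_Bad (ltn0Sn m) hC _ Bx).
  exact: (near_rational_prod_map hr hK iD nx).
have [a aD] := prod_digits_neq0 hK.
have {Bu} : fine (mu (Bad_const (prod_set K) tau c)) <= 0.
  apply: le_trans Bu _.
  rewrite (@eq0_of_window_decay R r B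
    (r%:R `^ (- ((C%:R + 2) * prod_dim R D + 2))) u) //.
  - exact: powR_gt0.
  - rewrite -[leRHS](powRr0 r%:R); apply: ler_powR => //.
    rewrite oppr_le0 addr_ge0// mulr_ge0 ?addr_ge0 ?ler0n// sumr_ge0// => j _.
    exact: digit_dim_ge0.
  - by move=> s; apply: measure_fin; exact: measurable_avoid.
  - move=> s; apply: (measure_shift_le hr hK hmu);
      [exact: measurable_avoid|exact: measurable_avoid|].
    move=> i x iD Kx [_ ax]; split=> // m; rewrite addn0 => nx.
    apply: (ax m.+1); rewrite addn0 addnS -addSn.
    exact: (near_rational_prod_map hr hK iD nx).
  (* [L] exceeds no run length bound needed later: it dominates every run of the window at [s], and
     the windows kept start at [s + L]. *)
  - move=> s _; set L := (B * _)%N.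
    have u0 : 0 <= u (s + L)%N.
      by case/andP: (measure_fin mu (measurable_avoid C (s + L) 0)).
    apply: (@le_trans _ _
      ((1 - (\prod_j #|D j|%:R ^+ window_length r tau C s j)^-1)
        * u (s + L)%N)); last first.
      by rewrite ler_wpM2r// lerD2l lerN2; exact: agreeprobability_ge.
    apply: (le_trans _ (measure_window_le hr hK hmu
      (X := avoid C (s + L)) (L := L) aD _ _ _)); last first.
    + by move=> j; exact: hB.
    + move=> t i x iD Kx [_ ax]; split=> // m nx.
      apply: (ax m); rewrite addnS.
      exact: (near_rational_prod_map hr hK iD nx).
    + by move=> t; exact: measurable_avoid.
    have mAF : measurable
        (avoid C (s + L) L `\` near_fixed a (window_length r tau C s)
         : set (borelRn R n)).
      apply: measurableD; first exact: measurable_avoid.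
      exact: measurable_near_fixed.
    apply: fine_le; rewrite ?fin_num_measure//; try exact: measurable_avoid.
    apply: le_measure; rewrite ?inE//; try exact: measurable_avoid.
    (* Positions from [s + L] on are among those avoided; position [s] itself excludes [near_fixed],
       since a run at the start gives a rational point with denominator [r - 1]. *)
    move=> x [Kx ax]; split.
      split=> // m nx; apply: (ax (L + m)%N).
      by rewrite addn0 addnA (addnC L m).
    move=> nx; apply: (ax 0%N); rewrite !addn0.
    exact: (near_fixed_near_rational hr hK aD nx).
case/andP: (measure_fin mu mBad) => b0 _ b1.
by apply/eqP; rewrite eq_le b1 b0.
Qed.

End badly_approximable.

(** * Countable union over the constants *)

Theorem theorem2p1 (R : realType) (r n : nat) (hr : (2 <= r)%N)
  (hn : (1 <= n)%N)
  (D : 'I_n -> {set 'I_r}) (K : 'I_n -> set R)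
  (hK : forall j, is_attractor (D j) (K j))
  (mu : probability (borelRn R n) R)
  (hmu : is_canonical_measure D (prod_set K) mu)
  (tau : 'I_n -> R) (htau : forall i, 0 < tau i)
  (hsum : \sum_(i < n) tau i * digit_dim R (D i) = 1) :
  mu (Bad_Int (prod_set K) tau) = 0%E.
Proof.
have cK := closed_attractor_prod hK.
have mB k : measurable
    (Bad_const (prod_set K) tau k.+1%:R^-1 : set (borelRn R n)).
  exact: measurable_Bad_const.
rewrite Bad_IntE; apply: measure_negligible.
  by apply: bigcupT_measurable => k; exact: mB.
apply: negligible_bigcup => k; apply/negligibleP; first exact: mB.
have k0 : 0 < k.+1%:R^-1 :> R by rewrite invr_gt0.
have := fineK (fin_num_measure mu _ (mB k)).
by rewrite (measure_Bad_const_eq0 hr hK htau hsum hmu k0) => <-.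
Qed.
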